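(* Let $K$ be a field of characteristic zero, let $F_3$ be the free algebra of rank $3$ with free generators $x_1,x_2,x_3$ in the variety $\mathcal{G}$ of unitary associative $K$-algebras satisfying $[[z_1,z_2],z_3]=0$, and let $F_3'$ be its commutator ideal. Then the left $K[X_3]^{S_3}$-module $(F_3')^{S_3}$ of symmetric polynomials in $F_3'$ is generated by the set $\{f_{0,1,0},f_{0,2,0},f_{1,2,0}\}$, where \[ f_{0,1,0}=(x_2-x_1)[x_2,x_1]+(x_3-x_1)[x_3,x_1]+(x_3-x_2)[x_3,x_2], \] \[ f_{0,2,0}=(x_2^2-x_1^2)[x_2,x_1]+(x_3^2-x_1^2)[x_3,x_1]+(x_3^2-x_2^2)[x_3,x_2], \] \[ f_{1,2,0}=(x_1x_2^2-x_1^2x_2)[x_2,x_1]+(x_1x_3^2-x_1^2x_3)[x_3,x_1]+(x_2x_3^2-x_2^2x_3)[x_3,x_2]. \]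
   Context: $[u,v]=uv-vu$. $\mathcal{G}$ is the variety of all unitary associative $K$-algebras satisfying the polynomial identity $[[z_1,z_2],z_3]=0$ (the variety generated by the infinite dimensional Grassmann algebra). The free algebra $F_3$ is the quotient of the free unitary associative algebra $K\langle x_1,x_2,x_3\rangle$ by the two-sided ideal generated by all elements $[[u,v],w]$, $u,v,w\in K\langle x_1,x_2,x_3\rangle$; the images of the generators are again denoted $x_1,x_2,x_3$. The commutator ideal is $F_3'=F_3[F_3,F_3]F_3$, the two-sided ideal generated by all commutators. $K[X_3]$ is the commutative polynomial algebra in $x_1,x_2,x_3$. For every $w\in F_3'$ and all $i,j$ one has $x_ix_jw=x_jx_iw$ in $F_3$, so left multiplication makes $F_3'$ a left $K[X_3]$-module (each variable $x_i$ acts by left multiplication by $x_i$). The symmetric group $S_3$ acts on $F_3$ (and on $K[X_3]$) by algebra automorphisms $\xi\cdot s(x_1,x_2,x_3)=s(x_{\xi 1},x_{\xi 2},x_{\xi 3})$; an element is called symmetric if it is fixed by all $\xi\in S_3$. $K[X_3]^{S_3}$ is the algebra of symmetric polynomials in $K[X_3]$ and $(F_3')^{S_3}$ is the set of symmetric elements of $F_3'$, which is a left $K[X_3]^{S_3}$-module. *)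

(* Defs.v *)
From HB Require Import structures.
From mathcomp Require Import all_boot all_order perm all_algebra.
From mathcomp Require Import boolp monalg.
From mathcomp Require Import mpoly.

Set Implicit Arguments.
Unset Strict Implicit.
Unset Printing Implicit Defensive.

Import GRing.Theory.
Local Open Scope ring_scope.
Local Open Scope quotient_scope.

(* monalg binds the same notation, for its own commutative polynomials, in
   type_scope, where it would shadow the one of mpoly. *)
Notation "{ 'mpoly' T [ n ] }" := (mpoly n T) : type_scope.

Definition lie (R : pzRingType) (u v : R) : R := u * v - v * u.

Inductive ideal_gen (R : pzRingType) (S : R -> Prop) : R -> Prop :=
| ideal_gen_mul a s b : S s -> ideal_gen S (a * s * b)
| ideal_gen0 : ideal_gen S 0
| ideal_genD x y : ideal_gen S x -> ideal_gen S y -> ideal_gen S (x + y).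

Section IdealGen.
Variables (R : pzRingType) (S : R -> Prop).

Lemma ideal_gen_sub x : S x -> ideal_gen S x.
Proof. by move=> Sx; rewrite -[x]mul1r -[1 * x]mulr1; apply: ideal_gen_mul. Qed.

Lemma ideal_genMl a x : ideal_gen S x -> ideal_gen S (a * x).
Proof.
elim=> [b s c Ss||y z _ IHy _ IHz]; last by rewrite mulrDr; apply: ideal_genD.
  by rewrite !mulrA; apply: ideal_gen_mul.
by rewrite mulr0; apply: ideal_gen0.
Qed.

Lemma ideal_genMr a x : ideal_gen S x -> ideal_gen S (x * a).
Proof.
elim=> [b s c Ss||y z _ IHy _ IHz]; last by rewrite mulrDl; apply: ideal_genD.
  by rewrite -mulrA; apply: ideal_gen_mul.
by rewrite mul0r; apply: ideal_gen0.
Qed.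

Lemma ideal_genB x y : ideal_gen S x -> ideal_gen S y -> ideal_gen S (x - y).
Proof. by move=> Sx Sy; apply: ideal_genD; rewrite // -mulN1r; apply: ideal_genMl. Qed.

End IdealGen.

Definition satisfiesG (R : pzRingType) : Prop :=
  forall u v w : R, lie (lie u v) w = 0.

(* {malg K[{fmonom 'I_n}]} is the monoid algebra of the free monoid on n
   letters, that is, the free unitary associative algebra K<x_1,...,x_n>. *)
Notation freealg K n := {malg K[{fmonom 'I_n}]} (only parsing).

Definition idealG (K : fieldType) (n : nat) : {pred freealg K n} :=
  fun z => `[< ideal_gen (fun s => exists u v w, s = lie (lie u v) w) z >].

Section RelativelyFree.
Variables (K : fieldType) (n : nat).
Local Notation A := (freealg K n).
Local Notation I := (@idealG K n).

Lemma idealG_zmod_closed : zmod_closed I.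
Proof.
split=> [|x y /asboolP Ix /asboolP Iy]; apply/asboolP; first exact: ideal_gen0.
exact: ideal_genB.
Qed.

HB.instance Definition _ := GRing.isZmodClosed.Build A I idealG_zmod_closed.

Lemma idealGMl a x : x \in I -> a * x \in I.
Proof. by move=> /asboolP Ix; apply/asboolP/ideal_genMl. Qed.

Lemma idealGMr a x : x \in I -> x * a \in I.
Proof. by move=> /asboolP Ix; apply/asboolP/ideal_genMr. Qed.

Lemma idealG_neq1 : 1 \notin I.
Proof.
apply/negP => /asboolP I1.
pose ev : A -> K := monalg.mcoeff (@monalg.one {fmonom 'I_n}).
have evM x y : ev (x * y) = ev x * ev y by exact: rmorphM.
have evB x y : ev (x - y) = ev x - ev y by exact: raddfB.
have evL x y : ev (lie x y) = 0.
  transitivity (ev x * ev y - ev y * ev x); last by rewrite mulrC subrr.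
  by rewrite -(evM x y) -(evM y x); exact: evB.
have evD x y : ev (x + y) = ev x + ev y by exact: raddfD.
have ev0 : ev 0 = 0 by exact: raddf0.
have ev1 : ev 1 = 1 by exact: rmorph1.
clearbody ev.
suff: ev 1 = 0 by move/eqP; rewrite ev1 oner_eq0.
elim: I1 => [a s b [u [v [w ->]]]||x y _ IHx _ IHy] //; last first.
  by rewrite evD IHx IHy addr0.
by rewrite (evM (a * _) b) (evM a _) (evL _ w) mulr0 mul0r.
Qed.

Definition relfree := Quotient.quot I.
HB.instance Definition _ := GRing.Zmodule.on relfree.
HB.instance Definition _ := EqQuotient.on relfree.

Definition cls (x : A) : relfree := \pi_relfree x.

Lemma clsW (P : relfree -> Prop) : (forall x, P (cls x)) -> forall y, P y.
Proof. by move=> Pcls y; rewrite -[y]reprK; apply: Pcls. Qed.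

Lemma cls_eq (x y : A) : reflect (cls x = cls y) (x - y \in I).
Proof. by rewrite Quotient.idealrBE; apply: eqP. Qed.

Lemma repr_cls (x : A) : repr (cls x) - x \in I.
Proof. by apply/cls_eq; rewrite /cls reprK. Qed.

Lemma cls_zmod_morphism : zmod_morphism cls.
Proof.
move=> x y; rewrite /cls.
by rewrite (@pi_addr _ _ _ _ _ (Quotient.quot I)) pi_oppr.
Qed.

HB.instance Definition _ :=
  GRing.isZmodMorphism.Build A relfree cls cls_zmod_morphism.

Definition relfree_mul : relfree -> relfree -> relfree := lift_op2 relfree *%R.
Definition relfree_scale (c : K) : relfree -> relfree := lift_op1 relfree ( *:%R c).

Lemma cls_mul x y : relfree_mul (cls x) (cls y) = cls (x * y).
Proof.
unlock relfree_mul; apply/cls_eq; set x' := repr _; set y' := repr _.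
have -> : x' * y' - x * y = x' * (y' - y) + (x' - x) * y.
  by rewrite mulrBr mulrBl addrA subrK.
by apply: rpredD; [apply: idealGMl|apply: idealGMr]; apply: repr_cls.
Qed.

Lemma cls_scale c x : relfree_scale c (cls x) = cls (c *: x).
Proof.
unlock relfree_scale; apply/cls_eq; rewrite -scalerBr -[_ - _]mul1r scalerAl.
by apply: idealGMl; apply: repr_cls.
Qed.

Lemma relfree_mulA : associative relfree_mul.
Proof.
by elim/clsW=> x; elim/clsW=> y; elim/clsW=> z; rewrite !cls_mul mulrA.
Qed.

Lemma relfree_mul1 : left_id (cls 1) relfree_mul.
Proof. by elim/clsW=> x; rewrite cls_mul mul1r. Qed.

Lemma relfree_mulr1 : right_id (cls 1) relfree_mul.
Proof. by elim/clsW=> x; rewrite cls_mul mulr1. Qed.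

Lemma relfree_mulDl : left_distributive relfree_mul +%R.
Proof.
elim/clsW=> x; elim/clsW=> y; elim/clsW=> z.
by rewrite -raddfD !cls_mul mulrDl raddfD.
Qed.

Lemma relfree_mulDr : right_distributive relfree_mul +%R.
Proof.
elim/clsW=> x; elim/clsW=> y; elim/clsW=> z.
by rewrite -raddfD !cls_mul mulrDr raddfD.
Qed.

Lemma relfree_1neq0 : cls 1 != 0.
Proof.
by rewrite -(raddf0 cls); apply/eqP => /cls_eq; rewrite subr0; apply/negP/idealG_neq1.
Qed.

HB.instance Definition _ := GRing.Zmodule_isNzRing.Build relfree
  relfree_mulA relfree_mul1 relfree_mulr1 relfree_mulDl relfree_mulDr
  relfree_1neq0.

Lemma cls_monoid_morphism : monoid_morphism cls.
Proof. by split=> [|x y]; [exact: erefl|exact/esym/cls_mul]. Qed.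

HB.instance Definition _ :=
  GRing.isMonoidMorphism.Build A relfree cls cls_monoid_morphism.

Lemma relfree_scaleA a b v :
  relfree_scale a (relfree_scale b v) = relfree_scale (a * b) v.
Proof. by elim/clsW: v => v; rewrite !cls_scale scalerA. Qed.

Lemma relfree_scale1 : left_id 1 relfree_scale.
Proof. by elim/clsW=> v; rewrite cls_scale scale1r. Qed.

Lemma relfree_scaleDr : right_distributive relfree_scale +%R.
Proof.
move=> a; elim/clsW=> u; elim/clsW=> v.
by rewrite -raddfD !cls_scale scalerDr raddfD.
Qed.

Lemma relfree_scaleDl v : {morph relfree_scale^~ v : a b / a + b}.
Proof.
by move=> a b; elim/clsW: v => v; rewrite !cls_scale scalerDl raddfD.
Qed.

HB.instance Definition _ := GRing.Zmodule_isLmodule.Build K relfree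
  relfree_scaleA relfree_scale1 relfree_scaleDr relfree_scaleDl.

Lemma cls_scalable : scalable cls.
Proof. by move=> c x; rewrite -cls_scale. Qed.

HB.instance Definition _ := GRing.isScalable.Build K A relfree *:%R cls
  cls_scalable.

Lemma relfree_scaleAl (a : K) (u v : relfree) : a *: (u * v) = (a *: u) * v.
Proof.
elim/clsW: u => u; elim/clsW: v => v.
by rewrite -rmorphM -!cls_scalable -rmorphM /= scalerAl.
Qed.

HB.instance Definition _ :=
  GRing.Lmodule_isLalgebra.Build K relfree relfree_scaleAl.

Lemma malgUZ (m : {fmonom 'I_n}) (c d : K) :
  c *: monalg.mkmalgU m d = monalg.mkmalgU m (c * d).
Proof.
apply/monalg.malgP => k; transitivity (c * (d *+ (m == k))).
  by rewrite -monalg.mcoeffU; exact: monalg.mcoeffZ.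
by rewrite monalg.mcoeffU mulrnAr.
Qed.

Lemma malg_scaleAr (c : K) (u v : A) : c *: (u * v) = u * (c *: v).
Proof.
rewrite (malgMEw (finmap.fsubset_refl _) (@monalg.msuppZ_le _ _ c v)) malgME scaler_sumr.
apply: eq_bigr => k1 _; rewrite scaler_sumr; apply: eq_bigr => k2 _.
have -> : monalg.mcoeff k2 (c *: v) = c * monalg.mcoeff k2 v.
  exact: monalg.mcoeffZ.
by rewrite malgUZ; congr (monalg.mkmalgU _ _); exact: mulrCA.
Qed.

Lemma relfree_scaleAr (a : K) (u v : relfree) : a *: (u * v) = u * (a *: v).
Proof.
elim/clsW: u => u; elim/clsW: v => v.
by rewrite -rmorphM -!cls_scalable -rmorphM /= malg_scaleAr.
Qed.

HB.instance Definition _ :=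
  GRing.Lalgebra_isAlgebra.Build K relfree relfree_scaleAr.

Lemma cls_lie u v : cls (lie u v) = lie (cls u) (cls v).
Proof.
have clsM x y : cls (x * y) = cls x * cls y by exact/esym/cls_mul.
by rewrite [RHS]/lie -(clsM u v) -(clsM v u); exact: raddfB.
Qed.

Lemma relfree_satisfiesG : satisfiesG relfree.
Proof.
move=> u v w; elim/clsW: u => u; elim/clsW: v => v; elim/clsW: w => w.
rewrite -!cls_lie -(raddf0 cls); apply/cls_eq; rewrite subr0.
by apply/asboolP/ideal_gen_sub; exists u, v, w.
Qed.

End RelativelyFree.

Section Universal.
Variables (K : fieldType) (n : nat).
Local Notation A := (freealg K n).
Local Notation F := (relfree K n).

Definition freegen (i : 'I_n) : A := monalg.mkmalgU (fmu i) 1.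
Definition relgen (i : 'I_n) : F := cls (freegen i).

Lemma free_ind (P : A -> Prop) :
  (forall c, P c%:A) -> (forall i, P (freegen i)) ->
  (forall x y, P x -> P y -> P (x + y)) ->
  (forall x y, P x -> P y -> P (x * y)) ->
  forall x, P x.
Proof.
move=> PC Pg PD PM x; rewrite [x]monalg.monalgE.
have P0 : P 0 by rewrite -(scale0r 1).
elim/big_rec: _ => // m y _; apply: PD; move: (_ x) => c.
have -> : monalg.mkmalgU m c = c%:A * monalg.mkmalgU m 1.
  by rewrite -scalerAl mul1r malgUZ mulr1.
apply: (PM) => //; case: m => s; elim: s => [|i s IHs].
  by rewrite -fmoneE; have := PC 1; rewrite scale1r.
have -> : monalg.mkmalgU (FMonom (i :: s)) 1 =
    freegen i * monalg.mkmalgU (FMonom s) 1 :> A.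
  rewrite monalg.malgME !monalg.msuppU1 !finmap.big_seq_fset1.
  rewrite !monalg.mcoeffUU mulr1; congr (monalg.mkmalgU _ _).
  by apply/val_inj; rewrite /= fmM fmU.
exact: PM.
Qed.

Lemma relfree_ind (P : F -> Prop) :
  (forall c, P c%:A) -> (forall i, P (relgen i)) ->
  (forall x y, P x -> P y -> P (x + y)) ->
  (forall x y, P x -> P y -> P (x * y)) ->
  forall x, P x.
Proof.
move=> PC Pg PD PM; elim/clsW.
elim/free_ind => [c|i|x y Px Py|x y Px Py].
- by rewrite cls_scalable; exact: PC.
- exact: Pg.
- by rewrite raddfD; apply: PD.
- by rewrite -cls_mul; apply: PM.
Qed.

Section Lift.
Variables (B : algType K) (h : 'I_n -> B).

Definition word_eval (m : {fmonom 'I_n}) : B := \prod_(i <- (m : seq 'I_n)) h i.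

Lemma word_eval_mmorphism : monalg.mmorphism word_eval.
Proof.
split=> [x y|]; first by rewrite /word_eval fmM big_cat.
by rewrite /word_eval fm1 big_nil.
Qed.

HB.instance Definition _ :=
  monalg.isMultiplicative.Build {fmonom 'I_n} B word_eval word_eval_mmorphism.

Definition free_eval : A -> B := monalg.mmap (in_alg B) word_eval.

HB.instance Definition _ := GRing.Additive.on free_eval.

Lemma free_eval_monoid_morphism : monoid_morphism free_eval.
Proof.
have [] := @monalg.commr_mmap_is_multiplicative _ _ _ (in_alg B) word_eval.
  by move=> g m m'; apply: commr_sym; rewrite /GRing.comm /= mulr_algl mulr_algr.
by [].
Qed.

HB.instance Definition _ :=
  GRing.isMonoidMorphism.Build A B free_eval free_eval_monoid_morphism.

Lemma free_eval_scalable : scalable free_eval.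
Proof.
by move=> c x; rewrite /free_eval monalg.mmapZ /= mulr_algl.
Qed.

HB.instance Definition _ :=
  GRing.isScalable.Build K A B *:%R free_eval free_eval_scalable.

Lemma free_eval_gen i : free_eval (freegen i) = h i.
Proof.
by rewrite /free_eval monalg.mmapU /= scale1r mul1r /word_eval fmU big_seq1.
Qed.

Definition relfree_lift (w : F) : B := free_eval (repr w).

Hypothesis GB : satisfiesG B.

Lemma free_eval_idealG z : z \in @idealG K n -> free_eval z = 0.
Proof.
have evM x y : free_eval (x * y) = free_eval x * free_eval y by exact: rmorphM.
have evB x y : free_eval (x - y) = free_eval x - free_eval y by exact: raddfB.
have evL x y : free_eval (lie x y) = lie (free_eval x) (free_eval y).
  by rewrite [RHS]/lie -(evM x y) -(evM y x); exact: evB.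
move=> /asboolP; elim=> [a s b [u [v [w ->]]]||x y _ IHx _ IHy].
- by rewrite (evM (a * _) b) (evM a _) (evL _ w) (evL u v) GB mulr0 mul0r.
- exact: raddf0.
- by have -> : free_eval (x + y) = free_eval x + free_eval y;
    [exact: raddfD|rewrite IHx IHy addr0].
Qed.

Lemma relfree_lift_cls x : relfree_lift (cls x) = free_eval x.
Proof.
apply/eqP; rewrite -subr_eq0; apply/eqP.
by rewrite -(free_eval_idealG (repr_cls x)); exact/esym/raddfB.
Qed.

Lemma relfree_lift_zmod_morphism : zmod_morphism relfree_lift.
Proof.
elim/clsW=> x; elim/clsW=> y.
have <- : cls (x - y) = cls x - cls y by exact: raddfB.
by rewrite !relfree_lift_cls; exact: raddfB.
Qed.

Lemma relfree_lift_monoid_morphism : monoid_morphism relfree_lift.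
Proof.
split=> [|x y]; first by rewrite (relfree_lift_cls 1); exact: rmorph1.
elim/clsW: x => x; elim/clsW: y => y.
by rewrite [_ * _]cls_mul !relfree_lift_cls; exact: rmorphM.
Qed.

Lemma relfree_lift_scalable : scalable relfree_lift.
Proof.
move=> c; elim/clsW=> x.
by rewrite -cls_scalable !relfree_lift_cls; exact: free_eval_scalable.
Qed.

Lemma relfree_lift_gen i : relfree_lift (relgen i) = h i.
Proof. by rewrite relfree_lift_cls free_eval_gen. Qed.

Lemma relfree_lift_uniq (f : {lrmorphism F -> B}) :
  (forall i, f (relgen i) = h i) -> f =1 relfree_lift.
Proof.
move=> fh; have [l1 lM] := relfree_lift_monoid_morphism.
elim/relfree_ind => [c|i|x y fx fy|x y fx fy].
- by rewrite relfree_lift_scalable l1 linearZ; congr (_ *: _); exact: rmorph1.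
- by rewrite fh relfree_lift_gen.
- have -> : f (x + y) = f x + f y by exact: raddfD.
  rewrite fx fy; move: x y {fx fy}; elim/clsW=> x; elim/clsW=> y.
  have <- : cls (x + y) = cls x + cls y by exact: raddfD.
  by rewrite !relfree_lift_cls; exact/esym/raddfD.
- by rewrite lM -fx -fy; exact: rmorphM.
Qed.

End Lift.
End Universal.

Section Symmetric.
Variables (K : fieldType) (n : nat).
Local Notation F := (relfree K n).

Definition perm_act (s : 'S_n) : F -> F :=
  relfree_lift (fun i => relgen K (s i)).

Section PermActMorphism.
Variable s : 'S_n.
Let FG := @relfree_satisfiesG K n.
Let hs i : F := relgen K (s i).

HB.instance Definition _ := GRing.isZmodMorphism.Build F F (perm_act s)
  (relfree_lift_zmod_morphism hs FG).
HB.instance Definition _ := GRing.isMonoidMorphism.Build F F (perm_act s)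
  (relfree_lift_monoid_morphism hs FG).
HB.instance Definition _ := GRing.isScalable.Build K F F *:%R (perm_act s)
  (relfree_lift_scalable hs FG).

Lemma perm_act_gen i : perm_act s (relgen K i) = relgen K (s i).
Proof. exact: relfree_lift_gen. Qed.

End PermActMorphism.

Definition comm_ideal : F -> Prop :=
  ideal_gen (fun z => exists u v, z = lie u v).

Definition sym_comm_ideal (w : F) : Prop :=
  comm_ideal w /\ forall s, perm_act s w = w.

(* The polynomial p is evaluated at the generators, each monomial being read as
   the ordered product x_1^m_1 ... x_n^m_n; on comm_ideal with n = 3 the order
   is irrelevant and this is a module structure, see poly_actM. *)
Definition poly_act (p : {mpoly K[n]}) (w : F) : F :=
  mpoly.mmap (in_alg F) (@relgen K n) p * w.

Definition sym_generates (M : F -> Prop) (G : seq F) : Prop :=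
  forall w, M w <->
    exists p : 'I_(size G) -> {mpoly K[n]},
      (forall i, p i \is symmetric) /\ w = \sum_i poly_act (p i) G`_i.

Lemma poly_actX i w : poly_act 'X_i w = relgen K i * w.
Proof. by rewrite /poly_act mpoly.mmapX mmap1U. Qed.

Lemma poly_act1 w : poly_act 1 w = w.
Proof. by rewrite /poly_act mpoly.mmapC /= scale1r mul1r. Qed.

Lemma poly_act0l w : poly_act 0 w = 0.
Proof. by rewrite /poly_act mpoly.mmap0 mul0r. Qed.

Lemma poly_act0r p : poly_act p 0 = 0.
Proof. exact: mulr0. Qed.

Lemma poly_actDl p q w : poly_act (p + q) w = poly_act p w + poly_act q w.
Proof. by rewrite /poly_act mpoly.mmapD mulrDl. Qed.

Lemma poly_actDr p w z : poly_act p (w + z) = poly_act p w + poly_act p z.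
Proof. exact: mulrDr. Qed.

Lemma poly_actZ c p w : poly_act (c *: p) w = c *: poly_act p w.
Proof. by rewrite /poly_act mpoly.mmapZ /= -mulrA mulr_algl. Qed.

Lemma poly_actZr c p w : poly_act p (c *: w) = c *: poly_act p w.
Proof. exact/esym/scalerAr. Qed.

Lemma poly_act_comm_ideal p w : comm_ideal w -> comm_ideal (poly_act p w).
Proof. exact: ideal_genMl. Qed.

End Symmetric.

Section LieTheory.
Variable R : pzRingType.
Hypothesis RG : satisfiesG R.
Implicit Types u v w z : R.

Lemma lieC u v : lie u v = - lie v u.
Proof. by rewrite /lie opprB. Qed.

Lemma lie_central u v w : lie u v * w = w * lie u v.
Proof. by apply/eqP; rewrite -subr_eq0; apply/eqP/RG. Qed.

Lemma lieMl u v w : lie (u * v) w = u * lie v w + lie u w * v.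
Proof. by rewrite /lie mulrBr mulrBl !mulrA addrA subrK. Qed.

Lemma lieDl u v w : lie (u + v) w = lie u w + lie v w.
Proof. by rewrite /lie mulrDl mulrDr opprD addrACA. Qed.

Lemma lie_lie_shared u v w : lie u v * lie u w = 0.
Proof.
have E : lie (v * u) u = lie v u * u.
  by rewrite lieMl /lie subrr mulr0 add0r.
have := RG (v * u) u w; rewrite E lieMl RG mul0r addr0 => E0.
by rewrite lieC mulNr E0 oppr0.
Qed.

End LieTheory.

Section Rank3.
Variable K : fieldType.
Local Notation F := (relfree K 3).
Local Notation g := (@relgen K 3).
Let FG := @relfree_satisfiesG K 3.

Lemma lie_lie_gen (i j k l : 'I_3) : lie (g i) (g j) * lie (g k) (g l) = 0.
Proof.
have lie0 (u : F) : lie u u = 0 by rewrite /lie subrr.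
have sh := lie_lie_shared FG.
case: (eqVneq i j) => [->|ij]; first by rewrite lie0 mul0r.
case: (eqVneq k l) => [->|kl]; first by rewrite lie0 mulr0.
case: (eqVneq i k) => [->|ik]; first exact: sh.
case: (eqVneq i l) => [->|il]; first by rewrite (lieC (g k)) mulrN sh oppr0.
case: (eqVneq j k) => [->|jk]; first by rewrite lieC mulNr sh oppr0.
case: (eqVneq j l) => [->|jl].
  by rewrite lieC mulNr (lieC (g k)) mulrN sh !oppr0.
have := max_card (mem [:: i; j; k; l]); rewrite card_ord (card_uniqP _) //=.
by rewrite !inE !negb_or ij ik il jk jl kl.
Qed.

Lemma lie_lie0 (a b c d : F) : lie a b * lie c d = 0.
Proof.
have lieA k (x : F) : lie k%:A x = 0 by rewrite /lie mulr_algl mulr_algr subrr.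
have ind (z b' : F) : (forall i, z * lie (g i) b' = 0) ->
    forall a', z * lie a' b' = 0.
  move=> zg; elim/relfree_ind => [k|//|x y Px Py|x y Px Py].
  - by rewrite lieA mulr0.
  - by rewrite lieDl mulrDr Px Py addr0.
  - rewrite lieMl -(lie_central FG y) mulrDr mulrA Py mul0r add0r.
    by rewrite mulrA Px mul0r.
have ind2 (z : F) : (forall i j, z * lie (g i) (g j) = 0) ->
    forall a' b', z * lie a' b' = 0.
  move=> zg a' b'; apply: (ind) => i; rewrite lieC mulrN.
  by rewrite ind ?oppr0 // => j; rewrite lieC mulrN zg oppr0.
apply: (ind2) => i j; rewrite lie_central //; apply: ind2 => k l.
exact: lie_lie_gen.
Qed.

Lemma mulC_comm_ideal (x y w : F) : comm_ideal w -> x * (y * w) = y * (x * w).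
Proof.
move=> Fw; apply/eqP; rewrite -subr_eq0 !mulrA -mulrBl; apply/eqP.
elim: Fw => [a s b [u [v ->]]||w1 w2 _ IH1 _ IH2].
- by rewrite !mulrA lie_central // -!mulrA [X in a * X]mulrA lie_lie0 mul0r mulr0.
- exact: mulr0.
- by rewrite mulrDr IH1 IH2 addr0.
Qed.

Lemma poly_actXX (m m' : 'X_{1..3}) (w : F) : comm_ideal w ->
  poly_act 'X_[m + m'] w = poly_act 'X_[m] (poly_act 'X_[m'] w).
Proof.
move=> Fw; rewrite /poly_act !mpoly.mmapX /mpoly.mmap1.
elim: (index_enum _) => [|i s IHs]; first by rewrite !big_nil !mul1r.
rewrite !big_cons mnmDE exprD -!mulrA.
rewrite IHs; congr (_ * _); apply: mulC_comm_ideal; exact: ideal_genMl.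
Qed.

Lemma poly_actM (p q : {mpoly K[3]}) (w : F) : comm_ideal w ->
  poly_act (p * q) w = poly_act p (poly_act q w).
Proof.
move=> Fw; elim/mpolyind: p => [|c m p _ _ IHp].
  by rewrite mul0r !poly_act0l.
rewrite mulrDl (poly_actDl _ _ w) (poly_actDl _ _ (poly_act q w)) IHp.
congr (_ + _); rewrite -scalerAl (poly_actZ _ _ w) (poly_actZ _ _ (poly_act q w)).
congr (_ *: _).
elim/mpolyind: q {IHp} => [|d m' q _ _ IHq].
  by rewrite mulr0 !poly_act0l poly_act0r.
rewrite mulrDr (poly_actDl _ _ w) IHq (poly_actDl _ q) poly_actDr.
congr (_ + _); rewrite -scalerAr (poly_actZ d _ w) (poly_actZ d _ w) poly_actZr.
by rewrite -mpolyXD (poly_actXX m m' Fw).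
Qed.

End Rank3.

Section Generators.
Variable K : fieldType.

Definition x1 : relfree K 3 := relgen K (@Ordinal 3 0 isT).
Definition x2 : relfree K 3 := relgen K (@Ordinal 3 1 isT).
Definition x3 : relfree K 3 := relgen K (@Ordinal 3 2 isT).

Definition f010 : relfree K 3 :=
  (x2 - x1) * lie x2 x1 + (x3 - x1) * lie x3 x1 + (x3 - x2) * lie x3 x2.

Definition f020 : relfree K 3 :=
  (x2 ^+ 2 - x1 ^+ 2) * lie x2 x1 + (x3 ^+ 2 - x1 ^+ 2) * lie x3 x1
  + (x3 ^+ 2 - x2 ^+ 2) * lie x3 x2.

Definition f120 : relfree K 3 :=
  (x1 * x2 ^+ 2 - x1 ^+ 2 * x2) * lie x2 x1
  + (x1 * x3 ^+ 2 - x1 ^+ 2 * x3) * lie x3 x1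
  + (x2 * x3 ^+ 2 - x2 ^+ 2 * x3) * lie x3 x2.

End Generators.

(* Main.v *)
Require Import Defs.
From mathcomp Require Import all_boot all_algebra.
From mathcomp Require Import perm mpoly ring.

(** Write L for [x2, x1].  Every symmetric element w of the commutator ideal is
    its own average over S_3, hence a sixth of its trace, the sum of its six
    images.  The ideal is spanned by the elements p [x_i, x_j] with p a
    polynomial, and each p [x_i, x_j] with i <> j is the image of some p' L under
    a permutation, so that it has the same trace as p' L.  Thus the trace of w is
    the trace of a single p L ([trace_comm_ideal]), and w is a sixth of it; this
    is where 6 has to be invertible.

    The map p |-> trace (p L), called [comm_trace], is linear over the symmetric
    polynomials, and over these the whole of K[X_3] is spanned by the six
    monomials x1^a x2^b with a < 2 and b < 3 ([mpoly3_sym_combination]).  The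
    problem therefore reduces to six traces ([comm_trace_basis]).  As s runs
    over S_3, the pair (s 2, s 1) runs over the ordered pairs of distinct
    indices, and grouping (i, j) with (j, i) gives the values
      1 |-> 0,   x2 |-> f010,    x2^2 |-> f020,
      x1 |-> - f010,   x1 x2 |-> 0,   x1 x2^2 |-> f120.

    Conversely the generators are traces, hence symmetric, and so are their
    combinations with symmetric coefficients, by linearity of the trace. *)

Import GRing.Theory.
Local Open Scope ring_scope.

Local Notation i1 := (@Ordinal 3 0 isT).
Local Notation i2 := (@Ordinal 3 1 isT).
Local Notation i3 := (@Ordinal 3 2 isT).

(** * Polynomials in three variables over the symmetric ones *)

Lemma mpoly_gen_ind (R : nzRingType) (n : nat) (P : {mpoly R[n]} -> Prop) :
  P 1 -> (forall c p, P p -> P (c *: p)) ->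
  (forall p q, P p -> P q -> P (p + q)) ->
  (forall i p, P p -> P ('X_i * p)) ->
  forall p, P p.
Proof.
move=> P1 PZ PD PX; elim/mpolyind => [|c m p _ _ Pp].
  by rewrite -(scale0r 1); apply: PZ.
apply: PD Pp; apply: PZ; rewrite mpolyXE_id.
elim/big_rec: _ => // i q _ Pq.
by elim: (m i) => [|k IHk]; rewrite ?expr0 ?mul1r // exprS -mulrA; apply: PX.
Qed.

Lemma msymU (R : nzRingType) (n : nat) (s : 'S_n) (i : 'I_n) :
  msym s ('X_i : {mpoly R[n]}) = 'X_(s i).
Proof. by rewrite /msym mmapX mmap1U. Qed.

Lemma sum_vars_symmetric (R : nzRingType) (n : nat) :
  \sum_(i < n) ('X_i : {mpoly R[n]}) \is symmetric.
Proof.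
apply/issymP => s; rewrite [RHS](reindex_inj (@perm_inj _ s)) /= raddf_sum.
by apply: eq_bigr => i _; rewrite /= msymU.
Qed.

Lemma prod_vars_symmetric (R : comNzRingType) (n : nat) :
  \prod_(i < n) ('X_i : {mpoly R[n]}) \is symmetric.
Proof.
apply/issymP => s; rewrite [RHS](reindex_inj (@perm_inj _ s)) /= rmorph_prod.
by apply: eq_bigr => i _; rewrite /= msymU.
Qed.

Lemma sum_prod_other_vars_symmetric (R : comNzRingType) (n : nat) :
  \sum_(i < n) \prod_(j < n | j != i) ('X_j : {mpoly R[n]}) \is symmetric.
Proof.
apply/issymP => s; rewrite [RHS](reindex_inj (@perm_inj _ s)) /= raddf_sum.
apply: eq_bigr => i _; rewrite /= rmorph_prod [RHS](reindex_inj (@perm_inj _ s)) /=.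
by apply: eq_big => [j|j _]; rewrite ?(inj_eq perm_inj) //= msymU.
Qed.

(** The six monomials form the Artin basis of the polynomial ring over the
    symmetric polynomials. *)
Definition sym_combination (R : comNzRingType) (p : {mpoly R[3]}) : Prop :=
  exists a b c d e f : {mpoly R[3]},
    [/\ [/\ a \is symmetric, b \is symmetric & c \is symmetric],
        [/\ d \is symmetric, e \is symmetric & f \is symmetric]
      & p = a + b * 'X_i2 + c * 'X_i2 ^+ 2
          + d * 'X_i1 + e * ('X_i1 * 'X_i2) + f * ('X_i1 * 'X_i2 ^+ 2)].

(** The combinations contain 1, so it suffices that they are stable under
    multiplication by each variable.  With e1, e2, e3 the elementary symmetric
    polynomials, x2 is a root of t^3 - e1 t^2 + e2 t - e3, which settles x2; the
    second complete symmetric polynomial in x1 and x2 equals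
    e1 (x1 + x2) - e2, which rewrites x1^2; and x3 = e1 - x1 - x2. *)
Lemma mpoly3_sym_combination (R : comNzRingType) (p : {mpoly R[3]}) :
  sym_combination R p.
Proof.
pose x : {mpoly R[3]} := 'X_i1; pose y : {mpoly R[3]} := 'X_i2.
pose z : {mpoly R[3]} := 'X_i3.
have [e1 s1 E1] : exists2 e1, e1 \is symmetric & e1 = x + y + z.
  eexists; first exact: sum_vars_symmetric.
  rewrite !big_ord_recr big_ord0 /= add0r.
  by congr ('X_ _ + 'X_ _ + 'X_ _); apply: val_inj.
have [e2 s2 E2] : exists2 e2, e2 \is symmetric & e2 = y * z + x * z + x * y.
  eexists; first exact: sum_prod_other_vars_symmetric.
  rewrite !big_ord_recr big_ord0 /= add0r.
  rewrite !(big_mkcond (fun j : 'I_3 => j != _)) /= !big_ord_recr !big_ord0 /=.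
  rewrite !mul1r !mulr1.
  by congr ('X_ _ * 'X_ _ + 'X_ _ * 'X_ _ + 'X_ _ * 'X_ _); apply: val_inj.
have [e3 s3 E3] : exists2 e3, e3 \is symmetric & e3 = x * y * z.
  eexists; first exact: prod_vars_symmetric.
  rewrite !big_ord_recr big_ord0 /= mul1r.
  by congr ('X_ _ * 'X_ _ * 'X_ _); apply: val_inj.
pose N := sym_combination R; rewrite -/(N p).
have ND q r : N q -> N r -> N (q + r).
  move=> [a [b [c [d [e [f [[? ? ?] [? ? ?] ->]]]]]]].
  move=> [a' [b' [c' [d' [e' [f' [[? ? ?] [? ? ?] ->]]]]]]].
  exists (a + a'), (b + b'), (c + c'), (d + d'), (e + e'), (f + f').
  by split; [split; exact: rpredD|split; exact: rpredD|rewrite -/x -/y; ring].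
have NM s q : s \is symmetric -> N q -> N (s * q).
  move=> ? [a [b [c [d [e [f [[? ? ?] [? ? ?] ->]]]]]]].
  exists (s * a), (s * b), (s * c), (s * d), (s * e), (s * f).
  by split; [split; exact: rpredM|split; exact: rpredM|rewrite -/x -/y; ring].
(* x2^3 = e1 x2^2 - e2 x2 + e3 *)
have Ny q : N q -> N (y * q).
  move=> [a [b [c [d [e [f [[? ? ?] [? ? ?] ->]]]]]]].
  exists (c * e3), (a - c * e2), (b + c * e1), (f * e3), (d - f * e2), (e + f * e1).
  split; [split|split|rewrite -/x -/y E1 E2 E3; ring];
  by do ?[apply: rpredB|apply: rpredD|apply: rpredM].
(* x1^2 = e1 (x1 + x2) - e2 - x2^2 - x1 x2 *)
have Nxx : N (x * x).
  exists (- e2), e1, (- 1), e1, (- 1), 0.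
  split; [split|split|rewrite -/x -/y E1 E2; ring];
  by rewrite ?rpredN ?rpred1 ?rpred0.
have Nx q : N q -> N (x * q).
  move=> [a [b [c [d [e [f [[? ? ?] [? ? ?] ->]]]]]]].
  have -> : x * (a + b * y + c * y ^+ 2 + d * x + e * (x * y) + f * (x * y ^+ 2))
     = (0 + 0 * y + 0 * y ^+ 2 + a * x + b * (x * y) + c * (x * y ^+ 2))
       + (d * (x * x) + (e * (y * (x * x)) + f * (y * (y * (x * x))))) by ring.
  apply: (ND); first by exists 0, 0, 0, a, b, c; split=> //; split; rewrite ?rpred0.
  have Nyxx := Ny _ Nxx; have Nyyxx := Ny _ Nyxx.
  by apply: (ND); [apply: (NM)|apply: (ND); apply: (NM)].
elim/mpoly_gen_ind: p => // [|c q Nq|i q Nq].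
- by exists 1, 0, 0, 0, 0, 0; split; [split|split|ring]; rewrite ?rpred0 ?rpred1.
- rewrite -mul_mpolyC; apply: (NM) => //.
  by rewrite -[c%:MP]mulr1 mul_mpolyC rpredZ ?rpred1.
have [->|->|->] : [\/ i = i1, i = i2 | i = i3].
  case: i => [[|[|[|//]]] lt_i]; [constructor 1|constructor 2|constructor 3];
  exact: val_inj.
- exact: Nx.
- exact: Ny.
rewrite -/z; have -> : z * q = e1 * q + ((-1) * (x * q) + (-1) * (y * q)).
  by rewrite E1; ring.
have sN1 : (-1 : {mpoly R[3]}) \is symmetric by rewrite rpredN rpred1.
by apply: (ND); [exact: NM|apply: (ND); apply: (NM) => //; [exact: Nx|exact: Ny]].
Qed.

(** * The action of the symmetric group *)

Lemma perm_actD (K : fieldType) (n : nat) (s : 'S_n) :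
  {morph @perm_act K n s : x y / x + y}.
Proof. exact: raddfD. Qed.

Lemma perm_actB (K : fieldType) (n : nat) (s : 'S_n) :
  {morph @perm_act K n s : x y / x - y}.
Proof. exact: raddfB. Qed.

Lemma perm_actM (K : fieldType) (n : nat) (s : 'S_n) :
  {morph @perm_act K n s : x y / x * y}.
Proof. exact: rmorphM. Qed.

Lemma perm_act0 (K : fieldType) (n : nat) (s : 'S_n) : perm_act s 0 = 0 :> relfree K n.
Proof. exact: raddf0. Qed.

Lemma perm_act1 (K : fieldType) (n : nat) (s : 'S_n) : perm_act s 1 = 1 :> relfree K n.
Proof. exact: rmorph1. Qed.

Lemma perm_actZ (K : fieldType) (n : nat) (s : 'S_n) (c : K) (w : relfree K n) :
  perm_act s (c *: w) = c *: perm_act s w.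
Proof. exact: linearZ. Qed.

Lemma perm_act_lie (K : fieldType) (n : nat) (s : 'S_n) (u v : relfree K n) :
  perm_act s (lie u v) = lie (perm_act s u) (perm_act s v).
Proof. by rewrite /lie perm_actB !perm_actM. Qed.

(** An ordered monomial is sent to a product of the same variables in another
    order.  The equation nevertheless holds, because variables commute in
    front of an element of the commutator ideal. *)
Lemma perm_act_poly_act (K : fieldType) (s : 'S_3) (p : {mpoly K[3]})
    (w : relfree K 3) :
  comm_ideal w ->
  perm_act s (poly_act p w) = poly_act (msym s p) (perm_act s w).
Proof.
have comm_act (v : relfree K 3) : comm_ideal v -> comm_ideal (perm_act s v).
  elim=> [a _ b [u [v' ->]]||x y _ IHx _ IHy].
  - rewrite !perm_actM perm_act_lie; apply: ideal_gen_mul.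
    by exists (perm_act s u), (perm_act s v').
  - by rewrite perm_act0; apply: ideal_gen0.
  - by rewrite perm_actD; exact: ideal_genD IHx IHy.
(* The image of w is made opaque, as the induction does not look inside it. *)
move=> Fw; have := comm_act w Fw; move: {-2}(perm_act s w) (erefl (perm_act s w)).
move=> v Ev Fv; elim/mpoly_gen_ind: p => [|c p IHp|p q IHp IHq|i p IHp].
- by rewrite msym1 !poly_act1.
- by rewrite poly_actZ msymZ poly_actZ perm_actZ IHp.
- by rewrite poly_actDl perm_actD msymD poly_actDl IHp IHq.
- rewrite (poly_actM _ p Fw) poly_actX perm_actM IHp perm_act_gen msymM msymU.
  by rewrite (poly_actM _ _ Fv) poly_actX.
Qed.

(** Both sides are algebra morphisms, and they agree on the generators. *)
Lemma perm_act_perm_act (K : fieldType) (n : nat) (s t : 'S_n) (w : relfree K n) :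
  perm_act s (perm_act t w) = perm_act (t * s)%g w.
Proof.
rewrite -[LHS]/((@perm_act K n s \o @perm_act K n t) w).
apply: (relfree_lift_uniq (@relfree_satisfiesG K n)) => i /=.
by rewrite !perm_act_gen permM.
Qed.

(** * The trace over the symmetric group *)

Definition trace (K : fieldType) (n : nat) (w : relfree K n) : relfree K n :=
  \sum_(s : 'S_n) perm_act s w.

Lemma trace0 (K : fieldType) (n : nat) : trace K n 0 = 0.
Proof. by rewrite /trace big1 // => s _; rewrite perm_act0. Qed.

Lemma traceD (K : fieldType) (n : nat) (v w : relfree K n) :
  trace K n (v + w) = trace K n v + trace K n w.
Proof. by rewrite /trace -big_split; apply: eq_bigr => s _; rewrite perm_actD. Qed.

Lemma traceZ (K : fieldType) (n : nat) (c : K) (w : relfree K n) :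
  trace K n (c *: w) = c *: trace K n w.
Proof. by rewrite /trace scaler_sumr; apply: eq_bigr => s _; rewrite perm_actZ. Qed.

Lemma perm_act_trace (K : fieldType) (n : nat) (s : 'S_n) (w : relfree K n) :
  perm_act s (trace K n w) = trace K n w.
Proof.
rewrite /trace (big_morph _ (perm_actD K n s) (perm_act0 K n s)).
rewrite [RHS](reindex_inj (mulIg s)) /=.
by apply: eq_bigr => t _; rewrite perm_act_perm_act.
Qed.

Lemma trace_perm_act (K : fieldType) (n : nat) (s : 'S_n) (w : relfree K n) :
  trace K n (perm_act s w) = trace K n w.
Proof.
rewrite /trace [RHS](reindex_inj (mulgI s)) /=.
by apply: eq_bigr => t _; rewrite perm_act_perm_act.
Qed.

Lemma trace_poly_act (K : fieldType) (p : {mpoly K[3]}) (w : relfree K 3) :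
  p \is symmetric -> comm_ideal w ->
  trace K 3 (poly_act p w) = poly_act p (trace K 3 w).
Proof.
move=> /issymP sp Fw; rewrite /trace (big_morph _ (poly_actDr p) (poly_act0r p)).
by apply: eq_bigr => s _; rewrite (perm_act_poly_act _ s p w Fw) sp.
Qed.

Lemma comm_lie (K : fieldType) (n : nat) (u v : relfree K n) : comm_ideal (lie u v).
Proof. by apply: ideal_gen_sub; exists u, v. Qed.

(** * Traces of elements of the commutator ideal *)

(** By symmetry the five other commutators of distinct generators contribute no
    further traces. *)
Definition comm_trace (K : fieldType) (p : {mpoly K[3]}) : relfree K 3 :=
  trace K 3 (poly_act p (lie (x2 K) (x1 K))).

Lemma comm_traceD (K : fieldType) (p q : {mpoly K[3]}) :
  comm_trace K (p + q) = comm_trace K p + comm_trace K q.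
Proof. by rewrite /comm_trace poly_actDl traceD. Qed.

Lemma comm_traceM (K : fieldType) (p q : {mpoly K[3]}) : p \is symmetric ->
  comm_trace K (p * q) = poly_act p (comm_trace K q).
Proof.
move=> sp; rewrite /comm_trace poly_actM; last exact: comm_lie.
by rewrite trace_poly_act //; apply/ideal_genMl/comm_lie.
Qed.

(** For i <> j this is the permutation with 2 |-> i and 1 |-> j: the first
    transposition puts i in place, the second corrects the image of 1 without
    moving i. *)
Definition perm_of_pair (i j : 'I_3) : 'S_3 :=
  (tperm i2 i * tperm (tperm i2 i i1) j)%g.

Lemma perm_of_pair1 (i j : 'I_3) : perm_of_pair i j i1 = j.
Proof. by rewrite permM tpermL. Qed.

Lemma perm_of_pair2 (i j : 'I_3) : i != j -> perm_of_pair i j i2 = i.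
Proof.
move=> neq_ij; rewrite permM tpermL [LHS]tpermD 1?[j == i]eq_sym //.
by rewrite -[X in _ != X](tpermL i2 i) (inj_eq perm_inj).
Qed.

Lemma perm3_ext (s t : 'S_3) : s i1 = t i1 -> s i2 = t i2 -> s = t.
Proof.
move=> e1 e2; apply/permP => i.
have [->//|ni1] := eqVneq i i1; have [->//|ni2] := eqVneq i i2.
(* Otherwise s i, t i and the two common values would be four distinct indices. *)
have out (r : 'S_3) : r i \notin [:: r i1; r i2].
  by rewrite !inE !(inj_eq perm_inj) negb_or ni1.
apply/eqP/negPn/negP => neq_st; have := max_card (mem [:: s i; t i; t i1; t i2]).
rewrite card_ord (card_uniqP _) //=.
have := out s; have := out t; rewrite e1 e2 !inE !negb_or => /andP[-> ->] /andP[-> ->].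
by rewrite neq_st (inj_eq perm_inj).
Qed.

(** A permutation of three points is determined by the ordered pair (s 2, s 1) of
    distinct indices, and every such pair occurs. *)
Lemma sum_perm3 (V : nmodType) (h : 'I_3 -> 'I_3 -> V) :
  \sum_(s : 'S_3) h (s i2) (s i1)
    = (h i2 i1 + h i1 i2) + (h i3 i1 + h i1 i3) + (h i3 i2 + h i2 i3).
Proof.
have sum3 (F : 'I_3 -> V) : \sum_(i < 3) F i = F i1 + F i2 + F i3.
  rewrite !big_ord_recr big_ord0 /= add0r.
  by congr (F _ + F _ + F _); apply: val_inj.
have -> : (h i2 i1 + h i1 i2) + (h i3 i1 + h i1 i3) + (h i3 i2 + h i2 i3)
    = \sum_(i < 3) \sum_(j < 3 | i != j) h i j.
  rewrite sum3 !(big_mkcond (fun j => _ != j)) !sum3 /= !add0r !addr0.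
  by rewrite [RHS](AC (2*2*2) ((3*1)*(5*2)*(6*4))).
rewrite (reindex_onto (fun ij => perm_of_pair ij.1 ij.2)
                      (fun s : 'S_3 => (s i2, s i1))) /=; last first.
  move=> s _; apply: perm3_ext; rewrite ?perm_of_pair1 // perm_of_pair2 //.
  by rewrite (inj_eq perm_inj).
rewrite pair_big_dep /=; apply: eq_big => [[i j]|[i j] /=] /=.
  have [<-|neq_ij] := eqVneq i j; last first.
    by rewrite perm_of_pair1 perm_of_pair2 // eqxx.
  apply/negbTE/eqP => -[e2 e1].
  by have := perm_inj (etrans e2 (esym e1)).
by move=> /eqP[-> ->].
Qed.

(** Commutators are central and lie (-) v is a derivation, so that the ideal is
    the left ideal spanned by the commutators of generators; since the trace is
    invariant, a permutation then carries each of these commutators to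
    [x2, x1]. *)
Lemma trace_comm_ideal (K : fieldType) (w : relfree K 3) : comm_ideal w ->
  exists p, trace K 3 w = comm_trace K p.
Proof.
(* Any left factor of an element of the ideal acts as a polynomial. *)
have poly_mul (a w' : relfree K 3) :
    comm_ideal w' -> exists p, a * w' = poly_act p w'.
  move=> Fw'; elim/relfree_ind: a => [c|i|x y [p Ex] [q Ey]|x y [p Ex] [q Ey]].
  - by exists (c *: 1); rewrite poly_actZ poly_act1 mulr_algl.
  - by exists 'X_i; rewrite poly_actX.
  - by exists (p + q); rewrite poly_actDl mulrDl Ex Ey.
  - exists (q * p); rewrite poly_actM // -Ex -mulrA Ey.
    by rewrite /poly_act (@mulC_comm_ideal K).
pose Q (v : relfree K 3) := exists p, trace K 3 v = comm_trace K p.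
have QD u v : Q u -> Q v -> Q (u + v).
  by move=> [p Eu] [q Ev]; exists (p + q); rewrite traceD Eu Ev comm_traceD.
have Q0 : Q 0 by exists 0; rewrite /comm_trace poly_act0l.
have QN u : Q u -> Q (- u).
  move=> [p Eu]; exists ((-1) *: p).
  by rewrite /comm_trace poly_actZ -scaleN1r !traceZ Eu.
have Qgen a i j : Q (a * lie (relgen K i) (relgen K j)).
  have [->|neq_ij] := eqVneq i j; first by rewrite /lie subrr mulr0.
  have [p ->] := poly_mul a _ (comm_lie K 3 (relgen K i) (relgen K j)).
  pose s := perm_of_pair i j; exists (msym s^-1%g p).
  rewrite /comm_trace -[RHS](trace_perm_act K 3 s) perm_act_poly_act; last first.
    exact: comm_lie.
  rewrite -msymMm mulVg msym1m perm_act_lie /x1 /x2 !perm_act_gen.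
  by rewrite perm_of_pair1 perm_of_pair2.
(* The derivation rule, with the right factor moved to the left by centrality. *)
have Qind v : (forall a i, Q (a * lie (relgen K i) v)) ->
    forall u a, Q (a * lie u v).
  move=> Qv; elim/relfree_ind=> [c|i|x y IHx IHy|x y IHx IHy] a.
  - by rewrite /lie mulr_algl mulr_algr subrr mulr0.
  - exact: Qv.
  - by rewrite lieDl mulrDr; exact: QD (IHx a) (IHy a).
  - rewrite lieMl (lie_central (@relfree_satisfiesG K 3) x v y) mulrDr !mulrA.
    exact: QD (IHy (a * x)) (IHx (a * y)).
have QC a u v : Q (a * lie v u) -> Q (a * lie u v).
  by rewrite (lieC u) mulrN; apply: QN.
rewrite -/(Q w); elim=> [a _ b [u [v ->]]||x y _ Qx _ Qy]; last 2 first.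
- exact: Q0.
- exact: QD Qx Qy.
rewrite -mulrA (lie_central (@relfree_satisfiesG K 3) u v b) mulrA.
apply: (Qind) => a' i; apply: QC; apply: (Qind) => a'' j.
exact: Qgen.
Qed.

(** Each unordered pair of indices contributes twice, with opposite commutators;
    hence the differences of coefficients, as in the three generators. *)
Lemma comm_trace_pairs (K : fieldType) (p : {mpoly K[3]})
    (c : 'I_3 -> 'I_3 -> relfree K 3) :
  (forall s : 'S_3, perm_act s (poly_act p (lie (x2 K) (x1 K)))
     = c (s i2) (s i1) * lie (relgen K (s i2)) (relgen K (s i1))) ->
  comm_trace K p = (c i2 i1 - c i1 i2) * lie (x2 K) (x1 K)
    + (c i3 i1 - c i1 i3) * lie (x3 K) (x1 K)
    + (c i3 i2 - c i2 i3) * lie (x3 K) (x2 K).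
Proof.
move=> Ep; pose h i j := c i j * lie (relgen K i) (relgen K j).
have -> : comm_trace K p = \sum_(s : 'S_3) h (s i2) (s i1).
  by apply: eq_bigr => s _; rewrite Ep.
have hB i j : (c i j - c j i) * lie (relgen K i) (relgen K j) = h i j + h j i.
  by rewrite mulrBl /h (lieC (relgen K j)) mulrN.
by rewrite sum_perm3 !hB.
Qed.

Lemma comm_trace_basis (K : fieldType) :
  [/\ comm_trace K 1 = 0, comm_trace K 'X_i2 = f010 K,
      comm_trace K ('X_i2 ^+ 2) = f020 K &
      [/\ comm_trace K 'X_i1 = - f010 K, comm_trace K ('X_i1 * 'X_i2) = 0
        & comm_trace K ('X_i1 * 'X_i2 ^+ 2) = f120 K]].
Proof.
have FL (u v : relfree K 3) : comm_ideal (lie u v) := comm_lie K 3 u v.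
have F2 (a u v : relfree K 3) : comm_ideal (a * lie u v).
  exact: ideal_genMl (FL u v).
have actL (s : 'S_3) (a : relfree K 3) : perm_act s (a * lie (x2 K) (x1 K))
    = perm_act s a * lie (relgen K (s i2)) (relgen K (s i1)).
  by rewrite perm_actM perm_act_lie /x1 /x2 !perm_act_gen.
split; [| | |split].
- rewrite (comm_trace_pairs K 1 (fun _ _ => 1)) => [|s].
    by rewrite subrr !mul0r !addr0.
  by rewrite poly_act1 -[lie (x2 K) _]mul1r actL perm_act1.
- apply: (comm_trace_pairs K _ (fun i _ => relgen K i)) => s.
  by rewrite poly_actX actL perm_act_gen.
- apply: (comm_trace_pairs K _ (fun i _ => relgen K i ^+ 2)) => s.
  by rewrite expr2 poly_actM // !poly_actX mulrA actL perm_actM perm_act_gen.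
- rewrite (comm_trace_pairs K _ (fun _ j => relgen K j)) => [|s].
    by rewrite /f010 /x1 /x2 /x3 !opprD -!mulNr !opprB.
  by rewrite poly_actX actL perm_act_gen.
- rewrite (comm_trace_pairs K _ (fun i j => relgen K j * relgen K i)) => [|s].
    (* In front of a commutator the factors of a coefficient commute. *)
    have sw (a b u v : relfree K 3) : (a * b - b * a) * lie u v = 0.
      by rewrite mulrBl -!mulrA (mulC_comm_ideal a b (FL u v)) subrr.
    by rewrite !sw !addr0.
  by rewrite poly_actM // !poly_actX mulrA actL perm_actM !perm_act_gen.
- rewrite (comm_trace_pairs K _ (fun i j => relgen K j * relgen K i ^+ 2)) => [|s].
    have sw (a b u v : relfree K 3) :
        (a * b ^+ 2 - b * a ^+ 2) * lie u v = (a * b ^+ 2 - a ^+ 2 * b) * lie u v.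
      rewrite !mulrBl -!mulrA (mulC_comm_ideal b a (F2 a u v)).
      by rewrite (mulC_comm_ideal b a (FL u v)).
    by rewrite !sw.
  rewrite expr2 poly_actM // poly_actM // !poly_actX !mulrA actL !perm_actM.
  by rewrite !perm_act_gen.
Qed.

(** Linearity over the symmetric polynomials extends the six values to all p. *)
Lemma comm_trace_generators (K : fieldType) (p : {mpoly K[3]}) :
  exists q1 q2 q3 : {mpoly K[3]},
    [/\ q1 \is symmetric, q2 \is symmetric, q3 \is symmetric
      & comm_trace K p
        = poly_act q1 (f010 K) + poly_act q2 (f020 K) + poly_act q3 (f120 K)].
Proof.
have [a [b [c [d [e [f [[sa sb sc] [sd se sf] ->]]]]]]] :=
  mpoly3_sym_combination K p.
have [T1 Ty Tyy [Tx Txy Txyy]] := comm_trace_basis K.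
exists (b - d), c, f; split=> //; first exact: rpredB.
rewrite -[a]mulr1 !comm_traceD (comm_traceM K a _ sa) (comm_traceM K b _ sb).
rewrite (comm_traceM K c _ sc) (comm_traceM K d _ sd) (comm_traceM K e _ se).
rewrite (comm_traceM K f _ sf).
rewrite T1 Ty Tyy Tx Txy Txyy !poly_act0r add0r addr0 poly_actDl.
rewrite -(mulN1r (f010 K)).
have -> : poly_act d (-1 * f010 K) = poly_act (- d) (f010 K).
  by rewrite mulN1r -scaleN1r poly_actZr -poly_actZ scaleN1r.
by congr (_ + _); rewrite addrAC.
Qed.

Theorem theorem3p5 (K : fieldType) (charK0 : [pchar K] =i pred0) :
  sym_generates (@sym_comm_ideal K 3) [:: f010 K; f020 K; f120 K].
Proof.
have [_ Ty Tyy [_ _ Txyy]] := comm_trace_basis K.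
have FT p : sym_comm_ideal (comm_trace K p).
  split; last by move=> s; apply: perm_act_trace.
  rewrite /comm_trace /trace; elim/big_ind: _ => [|u v|s _].
  - exact: ideal_gen0.
  - exact: ideal_genD.
  - rewrite perm_act_poly_act; last exact: comm_lie.
    by rewrite perm_act_lie; apply/ideal_genMl/comm_lie.
move=> w; split=> [[Fw fixw]|[p [sp ->]]].
  have [p Ep] := trace_comm_ideal K w Fw.
  have [q1 [q2 [q3 [s1 s2 s3 Eq]]]] := comm_trace_generators K p.
  have n6 : #|'S_3|%:R != 0 :> K.
    by rewrite (iffLR (pcharf0P K) charK0) -lt0n; apply/card_gt0P; exists 1%g.
  have trw : trace K 3 w = #|'S_3|%:R *: w.
    rewrite /trace (eq_bigr (fun=> w)) => [|s _]; last exact: fixw.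
    by rewrite sumr_const scaler_nat.
  pose k := (#|'S_3|%:R : K)^-1.
  exists (fun i => nth 0 [:: k *: q1; k *: q2; k *: q3] i); split.
    by case=> [[|[|[|//]]] ?] /=; apply: rpredZ.
  rewrite !big_ord_recl big_ord0 /= addr0 !poly_actZ -!scalerDr addrA -Eq -Ep trw.
  by rewrite scalerA mulVf // scale1r.
have sym_span i : exists q, [:: f010 K; f020 K; f120 K]`_i = comm_trace K q.
  case: i => [|[|[|i]]] /=; [by exists 'X_i2|by exists ('X_i2 ^+ 2)| |].
    by exists ('X_i1 * 'X_i2 ^+ 2).
  by exists 0; rewrite nth_nil /comm_trace poly_act0l trace0.
elim/big_ind: _ => [|u v [Fu fu] [Fv fv]|i _].
- by split=> [|s]; [exact: ideal_gen0|exact: perm_act0].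
- by split=> [|s]; [exact: ideal_genD|rewrite perm_actD fu fv].
- by have [q ->] := sym_span i; rewrite -comm_traceM //; apply: FT.
Qed.
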